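(* Let $S$ be a semigroup, $T$ a subsemigroup of $S$, and let $H_i,h_i$ $(i\in I^1)$, $\lambda$ and $\tau$ be as in the context. Let $i\in I^1$ and let $s_1,s_2,\ldots,s_n\in S$. Then \[ h_is_1s_2\cdots s_n=t_1t_2\cdots t_nh_j, \] where $t_1,\ldots,t_n\in T^1$ and $j\in I^1$ are obtained as a result of the following recursion: \[ i_1=i,\qquad i_{k+1}=\lambda(i_k,s_k)\ (k=1,\ldots,n),\qquad j=i_{n+1},\qquad t_k=\tau(i_k,s_k)\ (k=1,\ldots,n). \] Furthermore: (i) If all $s_q\in T$ and $h_is_1s_2\cdots s_n\notin T$ then $h_is_1s_2\cdots s_n\,\mathscr{L}^T h_j$. (ii) If all $s_q\in T$ and $h_is_1s_2\cdots s_n\in T$ then $j=1$ and so $h_j=h_1=1$. (iii) If all $s_q\in T$ and $h_is_1s_2\cdots s_n\,\mathscr{R}^T h_i$ then $h_is_1s_2\cdots s_n\,\mathscr{H}^T h_j$.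
   Context: For a semigroup $S$, $S^1=S\cup\{1\}$ denotes $S$ with a new identity element $1\notin S$ adjoined (even if $S$ already has an identity); for $X\subseteq S$, $X^1=X\cup\{1\}$. For a subsemigroup $T$ of $S$: $u\,\mathscr{R}^T v$ iff $uT^1=vT^1$; $u\,\mathscr{L}^T v$ iff $T^1u=T^1v$; $\mathscr{H}^T=\mathscr{R}^T\cap\mathscr{L}^T$. These are relations on $S$, also used with the same definition on $S^1$ (where $\{1\}$ is a class by itself). Each class in $S$ lies wholly in $T$ or wholly in $S\setminus T$. $\{H_i:i\in I\}$ is the set of $\mathscr{H}^T$-classes in $S\setminus T$, with fixed representatives $h_i\in H_i$. Put $I^1=I\cup\{1\}$ with $1\notin I$, $H_1=\{1\}$ and $h_1=1$ (the adjoined identity). The mapping $\lambda:I^1\times S^1\to I^1$ is given by $\lambda(i,s)=j$ if $h_is\in H_j$, and $\lambda(i,s)=1$ if $h_is\in T$. The mapping $\tau:I^1\times S^1\to T^1$ is any fixed mapping satisfying $h_is=\tau(i,s)h_{\lambda(i,s)}$ for all $i\in I^1$, $s\in S^1$ (such a mapping exists). *)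

(* Defs.v *)
From HB Require Import structures.
From mathcomp Require Import all_boot.
From mathcomp Require Import boolp classical_sets.

Set Implicit Arguments.
Unset Strict Implicit.
Unset Printing Implicit Defensive.

Local Open Scope classical_set_scope.
Local Open Scope group_scope.

(* S^1: [None] is the new identity 1, adjoined even if S already has one. *)
Definition adjoin1 (S : Type) : Type := option S.

Definition adj (S : Type) (x : S) : adjoin1 S := Some x.

Section Adjoin1Monoid.
Variable S : semigroupType.

HB.instance Definition _ := Choice.on (adjoin1 S).

Definition adj_mul (x y : adjoin1 S) : adjoin1 S :=
  match x, y with
  | None, _ => y
  | _, None => x
  | Some a, Some b => adj (a * b)
  end.

Fact adj_mulA : associative adj_mul.
Proof. by move=> [a|] [b|] [c|] //=; rewrite mulgA. Qed.

Fact adj_mul1 : left_id None adj_mul.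
Proof. by case. Qed.

Fact adj_mulr1 : right_id None adj_mul.
Proof. by case. Qed.

HB.instance Definition _ :=
  isMonoid.Build (adjoin1 S) adj_mulA adj_mul1 adj_mulr1.

End Adjoin1Monoid.

Section RelativeGreen.
Variables (S : semigroupType) (T : set S).

Definition subsemigroup : Prop := forall x y, T x -> T y -> T (x * y).

Definition inT : set (adjoin1 S) := [set adj x | x in T].

Definition T1 : set (adjoin1 S) := inT `|` [set 1].

(* The relations are taken on S^1; on S one compares [adj u] and [adj v]. *)
Definition greenR (u v : adjoin1 S) : Prop :=
  [set u * t | t in T1] = [set v * t | t in T1].

Definition greenL (u v : adjoin1 S) : Prop :=
  [set t * u | t in T1] = [set t * v | t in T1].

Definition greenH (u v : adjoin1 S) : Prop := greenR u v /\ greenL u v.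

Definition Hclass (u : S) : set S := [set v | greenH (adj u) (adj v)].

Section Indexed.
Variable I : Type.

(* H enumerates, without repetition, the H^T-classes in S \ T. *)
Definition enumerates_Hclasses (H : I -> set S) : Prop :=
  injective H /\ range H = [set Hclass u | u in ~` T].

(* The index set I^1 is [option I], with [None] the extra index 1. *)
Definition H1 (H : I -> set S) (i : option I) : set (adjoin1 S) :=
  if i is Some k then [set adj x | x in H k] else [set 1].

Definition h1 (h : I -> S) (i : option I) : adjoin1 S :=
  if i is Some k then adj (h k) else 1.

Definition is_lambda (H : I -> set S) (h : I -> S)
    (lambda : option I -> adjoin1 S -> option I) : Prop :=
  (forall i s j, H1 H j (h1 h i * s) -> lambda i s = j) /\
  (forall i s, inT (h1 h i * s) -> lambda i s = None).

Definition is_tau (h : I -> S) (lambda : option I -> adjoin1 S -> option I)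
    (tau : option I -> adjoin1 S -> adjoin1 S) : Prop :=
  (forall i s, T1 (tau i s)) /\
  (forall i s, h1 h i * s = tau i s * h1 h (lambda i s)).

End Indexed.
End RelativeGreen.

(* Main.v *)
Require Import Defs.
From mathcomp Require Import all_boot.
From mathcomp Require Import boolp classical_sets.

Set Implicit Arguments.
Unset Strict Implicit.
Unset Printing Implicit Defensive.

Local Open Scope classical_set_scope.
Local Open Scope group_scope.

(** The factorization is a telescoping of the single-step identities
    h_i s = tau(i,s) h_(lambda(i,s)) ([telescope_prod]).

    The refined statements rest on one remark.  When h_i s lies outside T,
    lambda(i,s) names its own H^T-class, so h_i s and h_(lambda(i,s)) are
    H^T-related ([greenH_step]): the step changes the element only within its
    class.  Each of (i)-(iii) is then an induction on the word s_1 ... s_n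
    which replaces the prefix h_i s_1 by h_(i_2) and continues with the word
    s_2 ... s_n.  Write y for s_2 ... s_n.

    - For (i), L^T is a right congruence, so w = h_i s_1 y is L^T-related to
      h_(i_2) y; since T absorbs multiplication by T^1, all these elements lie
      outside T together ([greenL_run]).
    - For (ii), either h_i s_1 stays outside T and h_(i_2) y is in T by the
      same argument, or h_i s_1 is in T; in the latter case i_2 = 1, and 1 is
      a fixed state for letters of T ([run_None]).  The word cannot run out in
      the former case, since no h_i belongs to T ([run_inT]).
    - For (iii), if w is R^T-related to h_i then so is the intermediate
      element h_i s_1, hence also h_(i_2).  With h_(i_2) = u h_i s_1 for some
      u in T^1, left multiplication by u carries the relation between w and
      h_i s_1 to one between h_(i_2) y and h_(i_2), and the induction goes
      on: all the h_(i_k) lie in one R^T-class ([greenR_run]).  Combined with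
      (i) this gives the H^T-relation. *)

(** * Telescoping and iteration over ordinals *)

Lemma widen_lift0 (n : nat) (k : 'I_n) :
  widen_ord (leqnSn n.+1) (lift ord0 k) = lift ord0 (widen_ord (leqnSn n) k).
Proof. exact: val_inj. Qed.

Lemma widen_ord0 (n : nat) : widen_ord (leqnSn n.+1) ord0 = ord0.
Proof. exact: val_inj. Qed.

Lemma lift0_max (n : nat) : lift ord0 ord_max = ord_max :> 'I_n.+2.
Proof. exact: val_inj. Qed.

(** Moving [a] through the product from left to right, one factor at a time,
    turns each [x k] into [t k]. *)
Lemma telescope_prod (M : monoidType) (n : nat)
    (a : 'I_n.+1 -> M) (x t : 'I_n -> M) :
    (forall k : 'I_n,
       a (widen_ord (leqnSn n) k) * x k = t k * a (lift ord0 k)) ->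
  a ord0 * (\big[*%g/1]_(k < n) x k) = (\big[*%g/1]_(k < n) t k) * a ord_max.
Proof.
elim: n a x t => [|n IHn] a x t step.
  by rewrite !big_ord0 mulg1 mul1g; congr a; apply: val_inj.
rewrite !big_ord_recl mulgA -{1}(widen_ord0 n) step -!mulgA; congr (_ * _).
have /= -> := IHn (a \o lift ord0) (x \o lift ord0) (t \o lift ord0).
  by rewrite lift0_max.
by move=> k /=; rewrite -widen_lift0 step.
Qed.

Lemma foldl_ord (A B : Type) (f : A -> B -> A) (n : nat)
    (a : 'I_n.+1 -> A) (s : 'I_n -> B) :
    (forall k : 'I_n,
       a (lift ord0 k) = f (a (widen_ord (leqnSn n) k)) (s k)) ->
  a ord_max = foldl f (a ord0) [seq s k | k <- enum 'I_n].
Proof.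
elim: n a s => [|n IHn] a s step.
  by rewrite enum_ord0 /=; congr a; apply: val_inj.
rewrite enum_ordSl /= -map_comp -{1}(widen_ord0 n) -step -lift0_max.
apply: (IHn (a \o lift ord0) (s \o lift ord0)) => k /=.
by rewrite step widen_lift0.
Qed.

(** * Green's relations relative to a subsemigroup *)

Section RelativeGreenTheory.
Variables (S : semigroupType) (T : set S).

Lemma T1_1 : T1 T 1.
Proof. by right. Qed.

Lemma greenR_mulr u v : greenR T u v -> exists2 t, T1 T t & v = u * t.
Proof.
move=> uv; have : [set v * t | t in T1 T] v.
  by exists 1; [exact: T1_1 | rewrite mulg1].
by rewrite -uv => -[t Tt <-]; exists t.
Qed.

Lemma greenL_mull u v : greenL T u v -> exists2 t, T1 T t & v = t * u.
Proof.
move=> uv; have : [set t * v | t in T1 T] v.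
  by exists 1; [exact: T1_1 | rewrite mul1g].
by rewrite -uv => -[t Tt <-]; exists t.
Qed.

(** Left multiplication by any [x] of S^1 commutes with right multiplication by
    T^1, so it maps the coset u T^1 onto x u T^1. *)
Lemma greenR_congr x u v : greenR T u v -> greenR T (x * u) (x * v).
Proof.
have mul_image y : [set x * y * t | t in T1 T] =
    [set x * z | z in [set y * t | t in T1 T]].
  by rewrite image_comp; apply: eq_imagel => t _ /=; rewrite mulgA.
by rewrite /greenR !mul_image => ->.
Qed.

Lemma greenL_congr x u v : greenL T u v -> greenL T (u * x) (v * x).
Proof.
have mul_image y : [set t * (y * x) | t in T1 T] =
    [set z * x | z in [set t * y | t in T1 T]].
  by rewrite image_comp; apply: eq_imagel => t _ /=; rewrite mulgA.
by rewrite /greenL !mul_image => ->.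
Qed.

Hypothesis T_sub : subsemigroup T.

Lemma inT_mulr x t : inT T x -> T1 T t -> inT T (x * t).
Proof.
move=> [a Ta <-] [[b Tb <-]|->]; last by rewrite mulg1; exists a.
by exists (a * b) => //; apply: T_sub.
Qed.

Lemma inT_mull x t : inT T x -> T1 T t -> inT T (t * x).
Proof.
move=> [a Ta <-] [[b Tb <-]|->]; last by rewrite mul1g; exists a.
by exists (b * a) => //; apply: T_sub.
Qed.

Lemma T1_mul x y : T1 T x -> T1 T y -> T1 T (x * y).
Proof.
by move=> [Tx|->] Ty; [left; apply: inT_mulr | rewrite mul1g].
Qed.

Lemma T1_prod (s : seq S) :
  (forall x, x \in s -> T x) -> T1 T (\big[*%g/1]_(x <- s) adj x).
Proof.
move=> Ts; rewrite big_seq; apply: big_ind => [||x /Ts Tx].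
- exact: T1_1.
- exact: T1_mul.
- by left; exists x.
Qed.

Lemma sub_greenR u v :
  (exists2 t, T1 T t & v = u * t) ->
  [set v * t | t in T1 T] `<=` [set u * t | t in T1 T].
Proof.
move=> [a Ta ->] _ [t Tt <-].
by exists (a * t); [apply: T1_mul | rewrite mulgA].
Qed.

Lemma greenR_intro u v :
    (exists2 t, T1 T t & v = u * t) -> (exists2 t, T1 T t & u = v * t) ->
  greenR T u v.
Proof. by move=> uv vu; apply/seteqP; split; apply: sub_greenR. Qed.

Lemma greenR_inT u v : greenR T u v -> inT T u -> inT T v.
Proof. by move=> /greenR_mulr[t Tt ->] Tu; apply: inT_mulr. Qed.

Lemma greenL_inT u v : greenL T u v -> inT T u -> inT T v.
Proof. by move=> /greenL_mull[t Tt ->] Tu; apply: inT_mull. Qed.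

End RelativeGreenTheory.

(** * Reading a word of letters of the subsemigroup *)

Section Run.
Variables (S : semigroupType) (T : set S) (I : Type).
Variables (H : I -> set S) (h : I -> S).
Variable lambda : option I -> adjoin1 S -> option I.
Hypotheses (T_sub : subsemigroup T) (H_classes : enumerates_Hclasses T H).
Hypothesis h_repr : forall k : I, H k (h k).
Hypothesis lambda_spec : is_lambda T H h lambda.

Local Notation run := (foldl (fun i x => lambda i (adj x))).
Local Notation prod s := (\big[*%g/1]_(x <- s) adj x).

(** For i = 1 this is because 1 is adjoined.  Otherwise h_i is R^T-related to
    some u outside T, and h_i in T would put u in h_i T^1, hence in T. *)
Lemma h1_notin_T i : ~ inT T (h1 h i).
Proof.
case: i => [k|] /=; last by case.
have [_ ranH] := H_classes.
have [u nTu Hu] : [set Hclass T u | u in ~` T] (H k) by rewrite -ranH; exists k.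
have [uR _] : Hclass T u (h k) by rewrite Hu.
by move=> /(greenR_inT T_sub (esym uR))[v Tv [uv]]; apply: nTu; rewrite -uv.
Qed.

(** Every element outside T lies in some class [H k], whose index is the value
    of [lambda] and whose representative is [h k]. *)
Lemma greenH_step i x : ~ inT T (h1 h i * adj x) ->
  greenH T (h1 h i * adj x) (h1 h (lambda i (adj x))).
Proof.
move=> nTix.
have [y def_y] : exists y, h1 h i * adj x = adj y.
  by case: (i) => [k|]; [exists (h k * x) | exists x].
have [_ ranH] := H_classes.
have [k _ Hk] : range H (Hclass T y).
  by rewrite ranH; exists y => // Ty; apply: nTix; exists y.
have -> : lambda i (adj x) = Some k.
  by apply: lambda_spec.1; exists y; rewrite ?def_y // Hk.
by rewrite def_y; have := h_repr k; rewrite Hk.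
Qed.

(** A letter of T is sent by h_1 = 1 to an element of T, so the state 1 is
    absorbing. *)
Lemma run_None (s : seq S) : (forall x, x \in s -> T x) -> run None s = None.
Proof.
elim: s => //= x s IHs Ts.
have -> : lambda None (adj x) = None.
  apply: lambda_spec.2; rewrite /= mul1g.
  by exists x => //; apply: Ts; rewrite mem_head.
by apply: IHs => y sy; apply: Ts; rewrite inE sy orbT.
Qed.

(** No prefix of the product can lie in T, since the rest of the word would keep
    it there; so every step stays within an L^T-class. *)
Lemma greenL_run i (s : seq S) : (forall x, x \in s -> T x) ->
  ~ inT T (h1 h i * prod s) -> greenL T (h1 h i * prod s) (h1 h (run i s)).
Proof.
elim: s i => [|x s IHs] i Ts /=; first by rewrite big_nil mulg1.
have Ts' y : y \in s -> T y by move=> sy; apply: Ts; rewrite inE sy orbT.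
rewrite big_cons mulgA => nTw.
have nTix : ~ inT T (h1 h i * adj x).
  by move=> Tix; apply/nTw/inT_mulr => //; apply: T1_prod.
have [_ /(greenL_congr (prod s)) wL] := greenH_step nTix.
apply: (etrans wL); apply: IHs => // Tw'.
by apply/nTw/(greenL_inT T_sub (esym wL)).
Qed.

(** The state becomes 1 as soon as a prefix of the product falls into T, and this
    must happen: otherwise the last representative would itself be in T. *)
Lemma run_inT i (s : seq S) : (forall x, x \in s -> T x) ->
  inT T (h1 h i * prod s) -> run i s = None.
Proof.
elim: s i => [|x s IHs] i Ts /=; first by rewrite big_nil mulg1 => /h1_notin_T.
have Ts' y : y \in s -> T y by move=> sy; apply: Ts; rewrite inE sy orbT.
rewrite big_cons mulgA => Tw.
have [Tix|nTix] := pselect (inT T (h1 h i * adj x)).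
  by rewrite (lambda_spec.2 _ _ Tix) run_None.
have [_ /(greenL_congr (prod s)) wL] := greenH_step nTix.
by apply: IHs => //; apply: greenL_inT wL Tw.
Qed.

(** The walk never leaves the R^T-class it starts from, provided that the whole
    product does not leave it. *)
Lemma greenR_run i (s : seq S) : (forall x, x \in s -> T x) ->
  greenR T (h1 h i * prod s) (h1 h i) -> greenR T (h1 h (run i s)) (h1 h i).
Proof.
elim: s i => [|x s IHs] i Ts //=.
have Ts' y : y \in s -> T y by move=> sy; apply: Ts; rewrite inE sy orbT.
rewrite big_cons mulgA => wR.
have T1s := T1_prod T_sub Ts'.
have T1x : T1 T (adj x) by left; exists x => //; apply: Ts; rewrite mem_head.
have ixR : greenR T (h1 h i * adj x) (h1 h i).
  apply: greenR_intro => //; last by exists (adj x).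
  (* h_i = w t = (h_i x) (prod s * t) *)
  have [t T1t def_i] := greenR_mulr wR.
  by exists (prod s * t); [apply: T1_mul | rewrite mulgA].
have nTix : ~ inT T (h1 h i * adj x).
  by move=> /(greenR_inT T_sub ixR)/h1_notin_T.
have [i2R /greenL_mull[u _ def_i2]] := greenH_step nTix.
apply: etrans (IHs _ Ts' _) (etrans (esym i2R) ixR).
rewrite def_i2 -mulgA; apply: greenR_congr.
exact: etrans wR (esym ixR).
Qed.

End Run.

Theorem lemma3p2 (S : semigroupType) (T : set S) (I : Type)
    (H : I -> set S) (h : I -> S)
    (lambda : option I -> adjoin1 S -> option I)
    (tau : option I -> adjoin1 S -> adjoin1 S)
    (T_sub : subsemigroup T)
    (H_classes : enumerates_Hclasses T H)
    (h_repr : forall k : I, H k (h k))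
    (lambda_spec : is_lambda T H h lambda)
    (tau_spec : is_tau T h lambda tau)
    (i : option I) (n : nat) (s : 'I_n -> S)
    (idx : 'I_n.+1 -> option I) (t : 'I_n -> adjoin1 S) (j : option I)
    (idx_first : idx ord0 = i)
    (idx_step : forall k : 'I_n,
       idx (lift ord0 k) = lambda (idx (widen_ord (leqnSn n) k)) (adj (s k)))
    (idx_last : j = idx ord_max)
    (t_step : forall k : 'I_n,
       t k = tau (idx (widen_ord (leqnSn n) k)) (adj (s k))) :
  let w := h1 h i * \big[*%g/1]_(k < n) adj (s k) in
  [/\ forall k : 'I_n, T1 T (t k),
      w = (\big[*%g/1]_(k < n) t k) * h1 h j,
      (forall q : 'I_n, T (s q)) -> ~ inT T w -> greenL T w (h1 h j),
      (forall q : 'I_n, T (s q)) -> inT T w -> j = None /\ h1 h j = 1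
    & (forall q : 'I_n, T (s q)) -> greenR T w (h1 h i) -> greenH T w (h1 h j)].
Proof.
move=> w.
have jE : j = foldl (fun i x => lambda i (adj x)) i [seq s k | k <- enum 'I_n].
  by rewrite idx_last -idx_first; apply: foldl_ord.
have wE : w = h1 h i * \big[*%g/1]_(x <- [seq s k | k <- enum 'I_n]) adj x.
  by rewrite big_map enumT /w [index_enum _]unlock.
have Ts : (forall q, T (s q)) ->
    forall x, x \in [seq s k | k <- enum 'I_n] -> T x.
  by move=> Tsq _ /mapP[k _ ->].
have wL : (forall q, T (s q)) -> ~ inT T w -> greenL T w (h1 h j).
  by move=> /Ts Ts'; rewrite wE jE; apply: greenL_run lambda_spec _ _ Ts'.
split=> // [k|||Tsq wR].
- by rewrite t_step; apply: tau_spec.1.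
- rewrite /w -idx_first idx_last.
  apply: (telescope_prod (a := h1 h \o idx)) => k /=.
  by rewrite idx_step t_step -tau_spec.2.
- move=> /Ts Ts'; rewrite wE => Tw.
  by have -> : j = None by rewrite jE; apply: run_inT lambda_spec _ _ Ts' Tw.
have nTw : ~ inT T w.
  by move=> /(greenR_inT T_sub wR); apply: h1_notin_T H_classes h_repr _.
split; last exact: wL.
apply: (etrans wR); apply: esym; rewrite jE.
apply: (greenR_run T_sub H_classes h_repr lambda_spec (Ts Tsq)).
by rewrite -wE.
Qed.
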